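(* Let $E$ be a non-zero Archimedean Riesz space. Then for every $u\in E$ with $u\neq 0$ there exists a disjointness preserving linear functional $\phi:E\to\mathbb{R}$ such that $\phi(u)=1$.
   Context: A Riesz space is a real vector lattice. Elements $x,y$ of a Riesz space are disjoint, written $x\perp y$, if $|x|\wedge|y|=0$. A linear functional $\phi:E\to\mathbb{R}$ is disjointness preserving if $x\perp y$ in $E$ implies $\phi(x)\phi(y)=0$ (equivalently, $|\phi(x)|\wedge|\phi(y)|=0$). No order boundedness or continuity of $\phi$ is assumed. *)

(* Defs.v *)
From HB Require Import structures.
From mathcomp Require Import all_boot all_order all_algebra.
From mathcomp Require Import reals.

Set Implicit Arguments.
Unset Strict Implicit.
Unset Printing Implicit Defensive.

Import Order.TTheory GRing.Theory Num.Theory.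
Local Open Scope ring_scope.

(* The lattice operations are fields of the mixin, with the axioms of
   [Order.POrder_MeetJoin_isLattice]: a structure inheriting from both
   [GRing.Lmodule] and [Order.Lattice ring_display] would have to be declared
   before [Num.RealDomain]. The [latticeType] structure is recovered below. *)
HB.mixin Record isRieszSpace (R : numDomainType) E
    of GRing.Lmodule R E & Num.POrderedZmodule E := {
  riesz_leD2r : forall z x y : E, x <= y -> x + z <= y + z;
  riesz_leZ2l : forall (a : R) (x y : E), 0 <= a -> x <= y -> a *: x <= a *: y;
  riesz_meet : E -> E -> E;
  riesz_join : E -> E -> E;
  riesz_meetP : forall x y z : E,
    (x <= riesz_meet y z) = (x <= y) && (x <= z);
  riesz_joinP : forall x y z : E,
    (riesz_join x y <= z) = (x <= z) && (y <= z)
}.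

#[short(type="rieszType")]
HB.structure Definition RieszSpace (R : numDomainType) :=
  { E of GRing.Lmodule R E & Num.POrderedZmodule E & isRieszSpace R E }.

HB.instance Definition _ (R : numDomainType) (E : rieszType R) :=
  Order.POrder_MeetJoin_isLattice.Build ring_display (RieszSpace.sort E)
    (@riesz_meetP R E) (@riesz_joinP R E).

Section RieszTheory.
Context {R : numDomainType} {E : rieszType R}.

Definition riesz_abs (x : E) : E := Order.join x (- x).

Definition riesz_disjoint (x y : E) : Prop :=
  Order.meet (riesz_abs x) (riesz_abs y) = 0.

Definition disjointness_preserving (phi : {scalar E}) : Prop :=
  forall x y : E, riesz_disjoint x y -> phi x * phi y = 0.

End RieszTheory.

Definition archimedean_riesz (R : numDomainType) (E : rieszType R) : Prop :=
  forall x y : E, 0 <= x -> (forall n : nat, x *+ n <= y) -> x = 0.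

(* Main.v *)
Require Import Defs.
From HB Require Import structures.
From mathcomp Require Import all_boot all_order all_algebra.
From mathcomp Require Import reals.
From mathcomp Require Import boolp classical_sets.
Set Implicit Arguments.
Unset Strict Implicit.
Unset Printing Implicit Defensive.

Import Order.TTheory GRing.Theory Num.Theory.
Local Open Scope ring_scope.

(** An ideal that is maximal among those avoiding [u] is prime: of two disjoint
elements it contains at least one. Hence every linear functional vanishing on it
preserves disjointness, and some such functional takes the value 1 at [u]. *)

Definition step_closed (T : Type) (step : T -> T -> T -> Prop) (A : set T) :=
  forall x y z, A x -> A y -> step x y z -> A z.

(** A step has only two premises, and in a chain both lie in the larger of two members, so closed
    sets are stable under unions of chains and Zorn's lemma applies. The empty set is closed as
    well; [A0] keeps the maximal set from being empty. The lemma serves both for ideals and for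
    linear subspaces. *)
Lemma maximal_step_closed (T : Type) (step : T -> T -> T -> Prop) (u x0 : T)
    (A0 : set T) :
    A0 x0 -> step_closed step A0 -> ~ A0 u ->
  exists A, [/\ exists x, A x, step_closed step A, ~ A u &
    forall B, step_closed step B -> ~ B u ->
      (A `<=` B)%classic -> (B `<=` A)%classic].
Proof.
move=> A0x0 clA0 A0u.
have [F FP Ftot|A [[clA Au] maxA]] := @Zorn_bigcup T
    (fun A => step_closed step A /\ ~ A u).
  split=> [x y z [X FX Xx] [Y FY Yy] xyz|[X FX Xu]]; last by case: (FP X FX).
  have [XY|YX] := Ftot X Y FX FY.
    by exists Y => //; exact: (FP Y FY).1 (XY _ Xx) Yy xyz.
  by exists X => //; exact: (FP X FX).1 Xx (YX _ Yy) xyz.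
exists A; split=> // [|B clB Bu AB].
  apply: contrapT => noA; apply: (maxA A0); last by split.
  split=> [x Ax|A0A]; first by case: noA; exists x.
  by apply: noA; exists x0; exact: A0A.
by apply: contrapT => BA; apply: (maxA B).
Qed.

Section RieszOrder.
Context {R : realFieldType} {E : rieszType R}.
Implicit Types (a b : R) (x y z : E).

Lemma riesz_leD x y z t : x <= y -> z <= t -> x + z <= y + t.
Proof.
move=> xy zt; apply: le_trans (riesz_leD2r z _ _ xy) _.
by rewrite ![y + _]addrC; exact: riesz_leD2r.
Qed.

Lemma riesz_subr_le x y z : x <= y + z -> x - y <= z.
Proof. by move/(riesz_leD2r (- y)); rewrite addrAC subrr add0r. Qed.

Lemma riesz_absP x y : x <= y -> - x <= y -> riesz_abs x <= y.
Proof. by rewrite leUx => -> ->. Qed.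

Lemma riesz_ler_abs x : x <= riesz_abs x.
Proof. exact: leUl. Qed.

Lemma riesz_lerN_abs x : - x <= riesz_abs x.
Proof. exact: leUr. Qed.

Lemma riesz_abs_ge0 x : 0 <= riesz_abs x.
Proof.
(* Adding [x] and [- x] below [riesz_abs x] gives 0 <= 2|x|, which is then halved. *)
have := riesz_leD (riesz_ler_abs x) (riesz_lerN_abs x).
rewrite subrr -mulr2n -scaler_nat => /(riesz_leZ2l 2^-1).
by rewrite scaler0 scalerA mulVf ?pnatr_eq0// scale1r invr_ge0 ler0n; apply.
Qed.

Lemma riesz_ge0_abs x : 0 <= x -> riesz_abs x = x.
Proof.
move=> x0; apply/le_anti; rewrite riesz_ler_abs andbT riesz_absP//.
apply: le_trans (x0).
by have := riesz_leD2r (- x) _ _ x0; rewrite add0r subrr.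
Qed.

Lemma riesz_abs0 : riesz_abs (0 : E) = 0.
Proof. exact: riesz_ge0_abs. Qed.

Lemma riesz_abs_le0 x : riesz_abs x <= 0 -> x = 0.
Proof.
move=> x0; apply/le_anti; rewrite (le_trans (riesz_ler_abs x) x0) /=.
have := riesz_leD2r x _ _ (le_trans (riesz_lerN_abs x) x0).
by rewrite addNr add0r.
Qed.

Lemma riesz_addr_ge0 x y : 0 <= x -> 0 <= y -> 0 <= x + y.
Proof. by move=> x0 y0; rewrite -[0]addr0; exact: riesz_leD. Qed.

Lemma riesz_scale_ge0 a x : 0 <= a -> 0 <= x -> 0 <= a *: x.
Proof. by move=> a0 /(riesz_leZ2l a _ _ a0); rewrite scaler0. Qed.

Lemma riesz_leZl a b x : 0 <= x -> a <= b -> a *: x <= b *: x.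
Proof.
move=> x0; rewrite -subr_ge0 => /riesz_scale_ge0 -/(_ _ x0).
by move/(riesz_leD2r (a *: x)); rewrite add0r -scalerDl subrK.
Qed.

Lemma riesz_absD x y : riesz_abs (x + y) <= riesz_abs x + riesz_abs y.
Proof.
by apply: riesz_absP; rewrite ?opprD; apply: riesz_leD;
  rewrite ?riesz_ler_abs ?riesz_lerN_abs.
Qed.

Lemma riesz_absZ a x : riesz_abs (a *: x) <= `|a| *: riesz_abs x.
Proof.
have [a0|/ltW a0] := ger0P a; apply: riesz_absP.
- by apply: riesz_leZ2l; rewrite ?riesz_ler_abs.
- by rewrite -scalerN; apply: riesz_leZ2l; rewrite ?riesz_lerN_abs.
- rewrite -[a *: x]opprK -scalerN -scaleNr.
  by apply: riesz_leZ2l; rewrite ?oppr_ge0// riesz_lerN_abs.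
- by rewrite -scaleNr; apply: riesz_leZ2l; rewrite ?oppr_ge0// riesz_ler_abs.
Qed.

(* The nonempty [ideal_step]-closed sets are the Riesz ideals; leaving the empty set
in lets Zorn's lemma apply to the empty chain. *)
Definition ideal_step x y z :=
  exists2 a, 0 <= a & riesz_abs z <= a *: (riesz_abs x + riesz_abs y).

Lemma ideal_lin (I : set E) a x y :
  step_closed ideal_step I -> I x -> I y -> I (a *: x + y).
Proof.
(* This coefficient dominates both |a|, needed for [x], and 1, needed for [y]. *)
move=> clI Ix Iy; apply: (clI x y) => //; exists (`|a| + 1).
  by rewrite addr_ge0.
apply: le_trans (riesz_absD _ _) _; rewrite scalerDr; apply: riesz_leD.
  apply: le_trans (riesz_absZ _ _) _; apply: riesz_leZl (riesz_abs_ge0 _) _.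
  by rewrite lerDl.
rewrite -[leLHS]scale1r; apply: riesz_leZl (riesz_abs_ge0 _) _.
by rewrite lerDr.
Qed.

Lemma ideal_abs_add (I : set E) x y :
  step_closed ideal_step I -> I x -> I y -> I (riesz_abs x + riesz_abs y).
Proof.
move=> clI Ix Iy; apply: (clI x y) => //; exists 1 => //.
by rewrite scale1r riesz_ge0_abs// riesz_addr_ge0 ?riesz_abs_ge0.
Qed.

Lemma ideal_scale_abs (I : set E) a x :
  step_closed ideal_step I -> 0 <= a -> I x -> I (a *: riesz_abs x).
Proof.
move=> clI a0 Ix; apply: (clI x x) => //; exists a => //.
rewrite riesz_ge0_abs ?riesz_scale_ge0 ?riesz_abs_ge0//.
apply: riesz_leZ2l => //; rewrite -[leLHS]addr0.
exact: riesz_leD (lexx _) (riesz_abs_ge0 _).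
Qed.

(** For an ideal [I] this is the ideal generated by [I] and [x]. The sign of [p] is left free, since
    p <= |p| and |p| is again in [I]. *)
Definition ideal_adjoin (I : set E) x : set E :=
  fun z => exists p a, [/\ I p, 0 <= a & riesz_abs z <= p + a *: riesz_abs x].

Lemma ideal_adjoin_closed (I : set E) x :
  step_closed ideal_step I -> step_closed ideal_step (ideal_adjoin I x).
Proof.
move=> clI y z t [p [a [Ip a0 yp]]] [q [b [Iq b0 zq]]] [c c0 tc].
exists (c *: (p + q)), (c * (a + b)); split.
- have Ipq : I (p + q) by rewrite -[p]scale1r; exact: ideal_lin.
  have I0 : I 0 by rewrite -(addNr p) -scaleN1r; exact: ideal_lin.
  by rewrite -[_ *: _]addr0; exact: ideal_lin.
- by rewrite mulr_ge0 ?addr_ge0.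
rewrite -scalerA -scalerDr; apply: le_trans tc _; apply: riesz_leZ2l => //.
by rewrite scalerDl addrACA; exact: riesz_leD.
Qed.

(** Take [I] maximal among the ideals avoiding [u]. If neither [x] nor [y] were in [I], adjoining
    either one would capture [u], so |u| <= r + c|x| and |u| <= r + c|y| with [r] in [I]. Then (|u|
    - r)/c lies below |x| and |y|, hence below their meet 0, and |u| <= r forces [u] into [I]. *)
Lemma exists_prime_ideal (u : E) : u <> 0 ->
  exists I : set E, [/\ exists x, I x, step_closed ideal_step I, ~ I u &
    forall x y, riesz_disjoint x y -> I x \/ I y].
Proof.
move=> u0.
have [|//|I [I0 clI Iu maxI]] :=
    @maximal_step_closed E ideal_step u 0 (fun x => x = 0) erefl.
  move=> _ _ z -> -> [a _]; rewrite riesz_abs0 addr0 scaler0.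
  exact: riesz_abs_le0.
exists I; split=> // x y xy.
have adj z : ~ I z -> ideal_adjoin I z u.
  move=> Iz; apply: contrapT => Bu; apply: Iz.
  apply: (maxI _ (ideal_adjoin_closed clI) Bu) => [p Ip|].
    exists (riesz_abs p), 0; split=> //; last by rewrite scale0r addr0.
    by rewrite -[riesz_abs p]scale1r; exact: ideal_scale_abs.
  have [p Ip] := I0; exists (0 *: riesz_abs p), 1; split=> //.
    exact: ideal_scale_abs.
  by rewrite scale0r add0r scale1r.
apply: contrapT => /not_orP[/adj[p [a [Ip a0 up]]] /adj[q [b [Iq b0 uq]]]].
(* One [r] and one [c] serve both bounds on |u|; the summand 1 makes [c] invertible. *)
set r := riesz_abs p + riesz_abs q; pose c := a + b + 1.
have Ir : I r by exact: ideal_abs_add.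
have pr : p <= r.
  rewrite -[p]addr0; exact: riesz_leD (riesz_ler_abs _) (riesz_abs_ge0 _).
have qr : q <= r.
  rewrite -[q]add0r; exact: riesz_leD (riesz_abs_ge0 _) (riesz_ler_abs _).
have c0 : 0 < c by rewrite ltr_wpDl ?addr_ge0.
have bound s d z : s <= r -> d <= c ->
    riesz_abs u <= s + d *: riesz_abs z ->
    c^-1 *: (riesz_abs u - r) <= riesz_abs z.
  move=> sr dc us; rewrite -[riesz_abs z]scale1r.
  rewrite -(mulVf (lt0r_neq0 c0)) -scalerA.
  apply: riesz_leZ2l; first by rewrite invr_ge0 ltW.
  apply/riesz_subr_le/(le_trans us)/riesz_leD => //.
  exact: riesz_leZl (riesz_abs_ge0 _) dc.
have : c^-1 *: (riesz_abs u - r) <= 0.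
  rewrite -xy lexI (bound p a)// ?(bound q b)//.
    by rewrite /c -addrA addrCA lerDl addr_ge0.
  by rewrite /c -addrA lerDl addr_ge0.
move/(riesz_leZ2l c _ _ (ltW c0)).
rewrite scalerA mulfV ?lt0r_neq0// scale1r scaler0 => /(riesz_leD2r r).
rewrite subrK add0r => ur; apply: Iu; apply: (clI r r) => //; exists 1 => //.
rewrite scale1r; apply: le_trans ur _; rewrite -[leLHS]addr0.
exact: riesz_leD (riesz_ler_abs _) (riesz_abs_ge0 _).
Qed.

End RieszOrder.

(** A subspace [A] containing [M] and maximal among those avoiding [u] is a complement of the line
    spanned by [u]; the functional is the coordinate along that line. *)
Lemma separating_functional (K : fieldType) (V : lmodType K) (M : set V)
    (u : V) :
    (exists x, M x) -> (forall a x y, M x -> M y -> M (a *: x + y)) -> ~ M u ->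
  exists phi : {scalar V}, (forall x, M x -> phi x = 0) /\ phi u = 1.
Proof.
move=> [m0 Mm0] Mlin Mu.
have M0 : M 0 by rewrite -(addNr m0) -scaleN1r; exact: Mlin.
(* Adding [p] in [M] makes every nonempty closed set a subspace containing [M]. *)
pose step x y z := exists a p, M p /\ z = a *: x + y + p.
have [|//|A [[x0 Ax0] clA Au maxA]] := @maximal_step_closed V step u 0 M M0.
  move=> x y _ Mx My [a [p [Mp ->]]].
  by rewrite -[_ + y]scale1r; apply: (Mlin) => //; exact: Mlin.
have Alin a x y : A x -> A y -> A (a *: x + y).
  by move=> Ax Ay; apply: (clA x y) => //; exists a, 0; rewrite addr0.
have A0 : A 0 by rewrite -(addNr x0) -scaleN1r; exact: Alin.
have AZ a x : A x -> A (a *: x).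
  by move=> Ax; rewrite -[_ *: _]addr0; exact: Alin.
have AM p : M p -> A p.
  by move=> Mp; apply: (clA 0 0) => //; exists 0, p; rewrite scaler0 !add0r.
have decomp x : exists b, A (x - b *: u).
  have [Ax|nAx] := pselect (A x); first by exists 0; rewrite scale0r subr0.
  (* [B] is the sum of [A] and the line through [x]. It exceeds [A], so it contains [u]: modulo [A],
     u = b x with b nonzero because [u] is not in [A], and x = b^-1 u. *)
  pose B : set V := fun z => exists b, A (z - b *: x).
  have Bu : B u.
    apply: contrapT => nBu; apply: nAx; apply: (maxA B) => //.
    - move=> y z _ [b Ab] [c Ac] [a [p [Mp ->]]]; exists (a * b + c).
      apply: (clA _ _ _ Ab Ac); exists a, p; split=> //.
      by rewrite scalerDl opprD scalerBr scalerA [in RHS]addrACA [RHS]addrAC.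
    - by move=> y Ay; exists 0; rewrite scale0r subr0.
    - by exists 1; rewrite scale1r subrr.
  have [b Ab] := Bu; have b0 : b != 0.
    by apply/eqP => b0; apply: Au; rewrite b0 scale0r subr0 in Ab.
  exists b^-1; have := AZ (- b^-1) _ Ab.
  by rewrite scalerBr scalerA mulNr mulVf// !scaleNr scale1r opprK addrC.
(* Subtracting the two memberships puts (b - c) u in [A], hence [u] itself if b and c differ.
   Linearity of the coordinate and its values on [M] and at [u] all follow from this uniqueness. *)
have uniq_coef x b c : A (x - b *: u) -> A (x - c *: u) -> b = c.
  move=> Ab Ac; apply: contrapT => /eqP; rewrite -subr_eq0 => bc.
  have := AZ (b - c)^-1 _ (Alin (-1) _ _ Ab Ac).
  rewrite scaleN1r opprB addrA subrK -scalerBl scalerA mulVf// scale1r.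
  exact: Au.
pose f x := projT1 (cid (decomp x)).
have fP x : A (x - f x *: u) by rewrite /f; case: cid.
have f_lin : linear_for *%R f.
  move=> a x y; apply: (uniq_coef (a *: x + y)) => //.
  have := Alin a _ _ (fP x) (fP y).
  by rewrite scalerBr scalerA addrACA -opprD -scalerDl.
pose fL := GRing.isLinear.Build K V K *%R f f_lin.
pose phi : {scalar V} := HB.pack f fL.
exists phi; split=> [x Mx|].
  by apply: (uniq_coef x) => //; rewrite scale0r subr0; exact: AM.
by apply: (uniq_coef u) => //; rewrite scale1r subrr.
Qed.

Theorem theorem2p2 (R : realType) (E : rieszType R)
    (E_nonzero : exists x : E, x <> 0)
    (E_archimedean : archimedean_riesz E) (u : E) (u_neq0 : u <> 0) :
  exists phi : {scalar E}, disjointness_preserving phi /\ phi u = 1.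
Proof.
have [I [I0 clI Iu prI]] := exists_prime_ideal u_neq0.
have [a x y|phi [phiI phiu]] := separating_functional I0 _ Iu.
  exact: ideal_lin.
exists phi; split=> // x y /prI[/phiI ->|/phiI ->].
  by rewrite mul0r.
by rewrite mulr0.
Qed.
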